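(* Let $\mathcal C$ be the path category of a thread quiver $(Q,\mathcal P)$, let $\mathcal I$ be an ideal of $\mathcal C$ and let $\mathcal A=\mathcal C/\mathcal I$. The class of indecomposable objects in $\mathrm{rep}^{\mathrm{pwf}}(\mathcal A)$ is the same as the class of indecomposable objects in $\mathrm{rep}^{\mathrm{qnf}}(\mathcal A)$.
   Context: $k$ is an algebraically closed field. A thread quiver $(Q,\mathcal P)$ consists of a (possibly infinite) quiver $Q=(Q_0,Q_1,s,t)$ and, for every arrow $\alpha$, a (possibly empty) linearly ordered set $\mathcal P_\alpha$; $\overline{\mathcal P}_\alpha=\mathcal P_\alpha\sqcup\{\min(\alpha),\max(\alpha)\}$ is obtained by adding a new least element $\min(\alpha)$ and a new greatest element $\max(\alpha)$. Its path category $\mathcal C$ is the $k$-linear category with object set $Q_0\sqcup\bigsqcup_\alpha\mathcal P_\alpha$, where $\min(\alpha),\max(\alpha)$ are viewed as the objects $s(\alpha),t(\alpha)$ (they remain distinct elements of $\overline{\mathcal P}_\alpha$ even if $\alpha$ is a loop). For $x\le y$ in $\overline{\mathcal P}_\alpha$ there is a morphism $\eta_{y,x}=\eta_{yx}:x\to y$, with $\eta_{xx}=e_x$ the identity, $\eta_{zy}\eta_{yx}=\eta_{zx}$ for $x\le y\le z$, and $\eta_{\max(\alpha),\min(\alpha)}=\alpha$; write $\eta_{t(\alpha),x}:=\eta_{\max(\alpha),x}$ and $\eta_{x,s(\alpha)}:=\eta_{x,\min(\alpha)}$. The space $\mathrm{Hom}_{\mathcal C}(x,y)$ has as $k$-basis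 the distinct path-like elements from $x$ to $y$: the identities $e_x$, the $\eta_{yx}$, and the elements $\eta_{y,s(\beta)}\,p\,\eta_{t(\alpha),x}$ with $x\in\overline{\mathcal P}_\alpha$, $y\in\overline{\mathcal P}_\beta$ and $p$ a (possibly trivial) path of $Q$ from $t(\alpha)$ to $s(\beta)$. Composition is induced by concatenation of paths in $Q$ together with the relations $\eta_{zy}\eta_{yx}=\eta_{zx}$ for $x\le y\le z$ in $\overline{\mathcal P}_\alpha$ and $\eta_{\max(\alpha),\min(\alpha)}=\alpha$, for every arrow $\alpha$. $\mathrm{rep}^{\mathrm{pwf}}(\mathcal A)$ is the category of covariant $k$-linear functors from $\mathcal A$ to finite-dimensional $k$-vector spaces, identified with the full subcategory of $\mathrm{rep}^{\mathrm{pwf}}(\mathcal C)$ of those $M$ with $M(f)=0$ for $f\in\mathcal I$. $M$ is noise if $M(x)=0$ for all $x\in Q_0$, and noise free if no nonzero direct summand of $M$ is noise. Every such $M$ has a decomposition, unique up to isomorphism of summands, $M=M_{NF}\oplus\bigoplus_{\alpha\in Q_1}U_\alpha$ with $M_{NF}$ noise free and $\mathrm{supp}(U_\alpha)\subseteq\mathcal P_\alpha$; $M$ is quasi noise free if each $U_\alpha$ is a finite direct sum of indecomposables. $\mathrm{rep}^{\mathrm{qnf}}(\mathcal A)$ is the full subcategory of $\mathrm{rep}^{\mathrm{pwf}}(\mathcal A)$ of quasi noise free representations. *)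

(* Defs.v *)
From HB Require Import structures.
From mathcomp Require Import all_boot all_order all_algebra.
From mathcomp Require Import boolp.
From mathcomp Require Import finmap monalg.

Set Implicit Arguments.
Unset Strict Implicit.
Unset Printing Implicit Defensive.

Import Order.TTheory GRing.Theory.
Local Open Scope ring_scope.

(* Composition is written in the order of functions: [comp g f] is g after f. *)
Record cat := Cat {
  cobj :> Type;
  chom : cobj -> cobj -> Type;
  cid : forall x, chom x x;
  ccomp : forall x y z, chom y z -> chom x y -> chom x z;
  ccomp1m : forall x y (f : chom x y), ccomp (cid y) f = f;
  ccompm1 : forall x y (f : chom x y), ccomp f (cid x) = f;
  ccompA : forall w x y z (h : chom y z) (g : chom x y) (f : chom w x),
    ccomp h (ccomp g f) = ccomp (ccomp h g) f
}.

Record linCat (k : fieldType) := LinCat {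
  obj :> Type;
  hom : obj -> obj -> lmodType k;
  idm : forall x, hom x x;
  comp : forall x y z, hom y z -> hom x y -> hom x z;
  comp_linearl : forall x y z (f : hom x y),
    linear (fun g : hom y z => comp g f);
  comp_linearr : forall x y z (g : hom y z),
    linear (fun f : hom x y => comp g f);
  comp1m : forall x y (f : hom x y), comp (idm y) f = f;
  compm1 : forall x y (f : hom x y), comp f (idm x) = f;
  compA : forall w x y z (h : hom y z) (g : hom x y) (f : hom w x),
    comp h (comp g f) = comp (comp h g) f
}.

Record ideal (k : fieldType) (C : linCat k) := Ideal {
  in_ideal :> forall x y, @hom k C x y -> Prop;
  ideal0 : forall x y, in_ideal (0 : @hom k C x y);
  ideal_linear : forall x y (c : k) (f g : @hom k C x y),
    in_ideal f -> in_ideal g -> in_ideal (c *: f + g);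
  ideal_compl : forall x y z (g : @hom k C y z) (f : @hom k C x y),
    in_ideal f -> in_ideal (comp g f);
  ideal_compr : forall x y z (g : @hom k C y z) (f : @hom k C x y),
    in_ideal g -> in_ideal (comp g f)
}.

Section LinearExtension.
Variables (k : fieldType) (K : choiceType).

Definition lext (V : lmodType k) (h : K -> V) (g : {malg k[K]}) : V :=
  \sum_(a <- msupp g) g@_a *: h a.

Lemma lextEw (V : lmodType k) (h : K -> V) (d : {fset K}) (g : {malg k[K]}) :
  fsubset (msupp g) d -> lext h g = \sum_(a <- d) g@_a *: h a.
Proof.
move=> le; rewrite /lext; apply: big_fset_incl => // a _ /mcoeff_outdom ->.
by rewrite scale0r.
Qed.

Lemma lext_linear (V : lmodType k) (h : K -> V) : linear (lext h).
Proof.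
move=> c f g; pose d := fsetU (msupp (c *: f + g)) (fsetU (msupp f) (msupp g)).
rewrite (@lextEw _ _ d) ?(@lextEw _ _ d f) ?(@lextEw _ _ d g).
- rewrite scaler_sumr -big_split; apply: eq_bigr => a _ /=.
  by rewrite mcoeffD mcoeffZ scalerDl scalerA.
- by apply/fsubsetP => a; rewrite /d !inE => ->; rewrite !orbT.
- by apply/fsubsetP => a; rewrite /d !inE => ->; rewrite !orbT.
- by apply/fsubsetP => a; rewrite /d !inE => ->.
Qed.

Lemma lextU (V : lmodType k) (h : K -> V) (a : K) :
  lext h (<< a >> : {malg k[K]}) = h a.
Proof. by rewrite /lext msuppU oner_eq0 big_seq_fset1 mcoeffUU scale1r. Qed.

Lemma lext_unique (V : lmodType k) (F : {malg k[K]} -> V) :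
  linear F -> F =1 lext (fun a => F << a >>).
Proof.
move=> Flin; pose Fm := GRing.isLinear.Build k _ _ _ F Flin.
pose F' : {linear {malg k[K]} -> V} := HB.pack F Fm.
move=> g; rewrite {1}(monalgE g) -[F]/(F' : _ -> _) raddf_sum.
apply: eq_bigr => a _; rewrite -linearZ; congr (F' _).
by apply/malgP => b; rewrite mcoeffZ !mcoeffU mulr_natr.
Qed.

Lemma eq_linear_malg (V : lmodType k) (F G : {malg k[K]} -> V) :
  linear F -> linear G -> (forall a : K, F << a >> = G << a >>) -> F =1 G.
Proof.
move=> Flin Glin FG g; rewrite (lext_unique Flin) (lext_unique Glin).
by apply: eq_bigr => a _; rewrite FG.
Qed.

End LinearExtension.

Section Linearization.
Variables (k : fieldType) (C : cat).

(* [classic] only supplies the choiceType structure needed by [malg]; lhom x y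
   is the free k-module on the morphisms from x to y. *)
Definition lhom (x y : C) : lmodType k := {malg k[{classic chom x y}]}.

Definition lbase (x y : C) (f : chom x y) : lhom x y :=
  << (f : {classic chom x y}) >>.

Definition lcomp (x y z : C) (g : lhom y z) (f : lhom x y) : lhom x z :=
  lext (fun b : {classic chom y z} =>
    lext (fun a : {classic chom x y} => lbase (ccomp b a)) f) g.

Lemma lcomp_linearl x y z (f : lhom x y) :
  linear (fun g : lhom y z => lcomp g f).
Proof. exact: lext_linear. Qed.

Lemma lcomp_linearr x y z (g : lhom y z) :
  linear (fun f : lhom x y => lcomp g f).
Proof.
move=> c f1 f2; rewrite /lcomp /lext scaler_sumr -big_split.
apply: eq_bigr => b _ /=; rewrite -!/(lext _ _) lext_linear scalerDr.
by rewrite !scalerA mulrC.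
Qed.

Lemma lcompU x y z (g : chom y z) (f : chom x y) :
  lcomp (lbase g) (lbase f) = lbase (ccomp g f).
Proof. by rewrite /lcomp !lextU. Qed.

Lemma lcomp1m x y (f : lhom x y) : lcomp (lbase (cid y)) f = f.
Proof.
apply: (eq_linear_malg (lcomp_linearr (lbase (cid y))) (G := id)) => // a.
by rewrite -/(lbase a) lcompU ccomp1m.
Qed.

Lemma lcompm1 x y (f : lhom x y) : lcomp f (lbase (cid x)) = f.
Proof.
apply: (eq_linear_malg (lcomp_linearl (lbase (cid x))) (G := id)) => // a.
by rewrite -/(lbase a) lcompU ccompm1.
Qed.

Lemma lcompA w x y z (h : lhom y z) (g : lhom x y) (f : lhom w x) :
  lcomp h (lcomp g f) = lcomp (lcomp h g) f.
Proof.
move: h; apply: eq_linear_malg => [||c].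
- by move=> a u v; rewrite lcomp_linearl.
- by move=> a u v; rewrite !lcomp_linearl.
move: g; apply: eq_linear_malg => [||b].
- by move=> a u v; rewrite lcomp_linearl lcomp_linearr.
- by move=> a u v; rewrite lcomp_linearr lcomp_linearl.
move: f; apply: eq_linear_malg => [||a].
- by move=> a u v; rewrite !lcomp_linearr.
- by move=> a' u v; rewrite !lcomp_linearr.
by rewrite -/(lbase a) -/(lbase b) -/(lbase c) !lcompU ccompA.
Qed.

Definition linearization : linCat k :=
  LinCat lcomp_linearl lcomp_linearr lcomp1m lcompm1 lcompA.

End Linearization.

Record quiver := Quiver {
  vertex :> Type;
  arrow : Type;
  qsrc : arrow -> vertex;
  qtgt : arrow -> vertex
}.

Record threadQuiver := ThreadQuiver {
  tquiver :> quiver;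
  tdisp : Order.disp_t;
  thread : arrow tquiver -> orderType tdisp
}.

Inductive qpath (Q : quiver) : Q -> Q -> Type :=
| qnil (v : Q) : qpath v v
| qcons (a : arrow Q) (w : Q) : qpath (qtgt a) w -> qpath (qsrc a) w.

Fixpoint qcat (Q : quiver) (u v w : Q) (p : qpath u v) :
    qpath v w -> qpath u w :=
  match p with
  | qnil _ => id
  | qcons a _ p' => fun q => qcons (qcat p' q)
  end.

Section PathCategory.
Variable T : threadQuiver.

Inductive tobj :=
| Vert (v : T)
| Pt (a : arrow T) (p : thread a).

(* [tout x] is the first vertex reached when leaving x, [tin x] the last vertex
   met before reaching x, and [through x] the path between them passing x. *)
Definition tout (x : tobj) : T :=
  match x with Vert v => v | Pt a _ => qtgt a end.

Definition tin (x : tobj) : T :=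
  match x with Vert v => v | Pt a _ => qsrc a end.

Definition through (x : tobj) : qpath (tin x) (tout x) :=
  match x with Vert v => qnil v | Pt a _ => qcons (qnil (qtgt a)) end.

(* Normal forms of the path-like elements from x to y. [Via p] is
   eta_{y,s(beta)} p eta_{t(alpha),x}, where the left (right) eta is absent when
   y (x) is a vertex; it accounts for all path-like elements which factor
   through a vertex. [Dir] is eta_{y,x} for x <= y strictly inside a thread. *)
Inductive plike : tobj -> tobj -> Type :=
| Via (x y : tobj) (p : qpath (tout x) (tin y)) : plike x y
| Dir (a : arrow T) (x y : thread a) of (x <= y)%O : plike (Pt x) (Pt y).

Definition pid (x : tobj) : plike x x :=
  match x with
  | Vert v => @Via (Vert v) (Vert v) (qnil v)
  | Pt a p => Dir (lexx p)
  end.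

Definition pcomp_via (x y z : tobj) (q : qpath (tout y) (tin z))
    (f : plike x y) : plike x z :=
  match f in plike x y return qpath (tout y) (tin z) -> plike x z with
  | Via x y p => fun q => @Via x z (qcat p (qcat (through y) q))
  | Dir a x y _ => fun q => @Via (Pt x) z q
  end q.

(* The result type of composing an element x -> w with some eta_{z,w}. *)
Definition dir_type (x w : tobj) : Type :=
  match w return Type with
  | Vert _ => unit
  | Pt a y => forall z : thread a, (y <= z)%O -> plike x (Pt z)
  end.

Definition via_dir (x w : tobj) : qpath (tout x) (tin w) -> dir_type x w :=
  match w return qpath (tout x) (tin w) -> dir_type x w with
  | Vert _ => fun _ => tt
  | Pt a y => fun p z _ => @Via x (Pt z) p
  end.

Definition pcomp_dir (x : tobj) (a : arrow T) (y z : thread a)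
    (yz : (y <= z)%O) (f : plike x (Pt y)) : plike x (Pt z) :=
  match f in plike x w return dir_type x w with
  | Via x w p => via_dir p
  | Dir b x y xy => fun z yz => Dir (le_trans xy yz)
  end z yz.

Definition pcomp (x y z : tobj) (g : plike y z) (f : plike x y) : plike x z :=
  match g in plike y z return plike x y -> plike x z with
  | Via y z q => pcomp_via q
  | Dir a y z yz => pcomp_dir yz
  end f.

Lemma qcatA (t u v w : T) (p : qpath t u) (q : qpath u v) (r : qpath v w) :
  qcat p (qcat q r) = qcat (qcat p q) r.
Proof. by elim: p q => //= a u' p IH q; rewrite IH. Qed.

Lemma qcat0 (u v : T) (p : qpath u v) : qcat p (qnil v) = p.
Proof. by elim: p => //= a w p ->. Qed.

Definition plike_pt_case (x : tobj) (a : arrow T)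
    (X : forall y : thread a, plike x (Pt y) -> Prop)
    (XVia : forall y p, X y (@Via x (Pt y) p))
    (XDir : forall (y0 y : thread a) (le : (y0 <= y)%O) (e : x = Pt y0),
      X y (eq_rect _ (fun u => plike u (Pt y)) (Dir le) _ (esym e))) :
  forall y f, X y f.
Proof.
move=> y f.
pose R (x : tobj) (w : tobj) : plike x w -> Prop :=
  match w return plike x w -> Prop with
  | Vert _ => fun _ => True
  | Pt b y => fun f => forall X : forall y : thread b, plike x (Pt y) -> Prop,
      (forall y p, X y (@Via x (Pt y) p)) ->
      (forall (y0 y : thread b) (le : (y0 <= y)%O) (e : x = Pt y0),
        X y (eq_rect _ (fun u => plike u (Pt y)) (Dir le) _ (esym e))) ->
      X y f
  end.
suff: R _ _ f by move=> /(_ X XVia XDir).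
case: {X XVia XDir a y} x _ / f => [x [v|a y] p | a x y le] //= X HVia HDir.
exact: (HDir x y le erefl).
Qed.

Lemma pcomp1m (x y : tobj) (f : plike x y) : pcomp (pid y) f = f.
Proof.
case: f => [{}x [v|a {}y] p | a {}x {}y xy] //=.
- by rewrite qcat0.
- by congr Dir; apply: bool_irrelevance.
Qed.

Lemma pcompm1 (x y : tobj) (f : plike x y) : pcomp f (pid x) = f.
Proof.
case: f => [[v|a {}x] {}y p | a {}x {}y xy] //=.
by congr Dir; apply: bool_irrelevance.
Qed.

Lemma pcompA (w x y z : tobj) (h : plike y z) (g : plike x y) (f : plike w x) :
  pcomp h (pcomp g f) = pcomp (pcomp h g) f.
Proof.
case: h g => [{}y {}z r | a {}y {}z yz] g.
  case: g r f => [{}x {}y q | a {}x {}y xy] r f /=.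
    case: f q => [{}w {}x p | a {}w {}x wx] q /=; last by [].
    by rewrite !qcatA.
  by move: y xy r; elim/plike_pt_case: x / f => [x p|x0 x le e] y xy r //=;
    case: _ / (esym e).
move: y g z yz; apply: plike_pt_case => [y q|y0 y xy e] z yz /=.
  by case: f q => [{}w {}x p | b {}w {}x wx] q.
subst x => /=.
move: y0 f y xy z yz; apply: plike_pt_case => [x p|w0 x wx e] y xy z yz //=.
by subst w => /=; congr Dir; apply: bool_irrelevance.
Qed.

Definition plike_cat : cat := Cat pcomp1m pcompm1 pcompA.

Definition pathcat (k : fieldType) : linCat k := linearization k plike_cat.

(* Not used below: eta_refl, eta_comp and Via_eta check that [plike] satisfies
   the defining relations of the path category. Here eta x y is eta_{y,x}. The
   relation eta_{max(a),min(a)} = a holds by definition. *)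
Inductive ethread (a : arrow T) := EMin | EPt of thread a | EMax.

Definition ele (a : arrow T) (x y : ethread a) : bool :=
  match x, y with
  | EMin, _ | _, EMax => true
  | EPt x, EPt y => (x <= y)%O
  | _, _ => false
  end.

Definition eobj (a : arrow T) (x : ethread a) : tobj :=
  match x with EMin => Vert (qsrc a) | EPt p => Pt p | EMax => Vert (qtgt a) end.

Definition qarrow (a : arrow T) : plike (Vert (qsrc a)) (Vert (qtgt a)) :=
  @Via (Vert (qsrc a)) (Vert (qtgt a)) (qcons (qnil (qtgt a))).

Definition eta (a : arrow T) (x y : ethread a) :
    ele x y -> plike (eobj x) (eobj y) :=
  match x, y return ele x y -> plike (eobj x) (eobj y) with
  | EMin, EMin => fun _ => pid (Vert (qsrc a))
  | EMin, EPt y => fun _ => @Via (Vert (qsrc a)) (Pt y) (qnil (qsrc a))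
  | EMin, EMax => fun _ => qarrow a
  | EPt x, EPt y => fun xy => Dir xy
  | EPt x, EMax => fun _ => @Via (Pt x) (Vert (qtgt a)) (qnil (qtgt a))
  | EMax, EMax => fun _ => pid (Vert (qtgt a))
  | EPt _, EMin | EMax, EMin | EMax, EPt _ =>
      fun lt => False_rect _ (notF lt)
  end.

Lemma eta_refl (a : arrow T) (x : ethread a) (xx : ele x x) :
  eta xx = pid (eobj x).
Proof. by case: x xx => //= x xx; congr Dir; apply: bool_irrelevance. Qed.

Lemma eta_comp (a : arrow T) (x y z : ethread a)
    (xy : ele x y) (yz : ele y z) (xz : ele x z) :
  pcomp (eta yz) (eta xy) = eta xz.
Proof.
case: x y z xy yz xz => [|x|] [|y|] [|z|] //= xy yz xz.
by congr Dir; apply: bool_irrelevance.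
Qed.

Lemma Via_eta (a b : arrow T) (x : thread a) (y : thread b)
    (p : qpath (qtgt a) (qsrc b)) (xmax : ele (EPt x) (EMax a))
    (miny : ele (EMin b) (EPt y)) :
  @Via (Pt x) (Pt y) p =
  pcomp (eta miny)
    (pcomp (@Via (Vert (qtgt a)) (Vert (qsrc b)) p) (eta xmax)).
Proof. by rewrite /= qcat0. Qed.

End PathCategory.

(* Objects of rep^pwf(C/I), as the linear functors on C vanishing on I. *)
Record rep (k : fieldType) (C : linCat k) (I : ideal C) := Rep {
  rep_obj :> C -> vectType k;
  rep_map : forall x y : C, {linear hom x y -> 'Hom(rep_obj x, rep_obj y)};
  rep_id : forall x : C, rep_map x x (idm x) = \1%VF;
  rep_comp : forall (x y z : C) (g : hom y z) (f : hom x y),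
    rep_map x z (comp g f) = (rep_map y z g \o rep_map x y f)%VF;
  rep_ideal : forall (x y : C) (f : hom x y), I x y f -> rep_map x y f = 0
}.

Section Representations.
Variables (k : fieldType) (C : linCat k) (I : ideal C).

Record repHom (M N : rep I) := RepHom {
  rh_map :> forall x : C, 'Hom(M x, N x);
  rh_natural : forall (x y : C) (f : hom x y),
    (rh_map y \o rep_map M x y f = rep_map N x y f \o rh_map x)%VF
}.

Definition zero_rep (M : rep I) : Prop := forall (x : C) (v : M x), v = 0.

(* M is the (pointwise) direct sum of the possibly infinite family N: the last
   condition says that each M x is spanned by the images of the inclusions. *)
Definition is_direct_sum (J : Type) (N : J -> rep I) (M : rep I) : Prop :=
  exists (inj : forall j, repHom (N j) M) (proj : forall j, repHom M (N j)),
  [/\ forall (j : J) (x : C) (v : N j x), proj j x (inj j x v) = v,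
      forall (i j : J) (x : C) (v : N i x), i <> j -> proj j x (inj i x v) = 0
    & forall (x : C) (v : M x), exists (s : seq J) (w : forall j, N j x),
        v = \sum_(j <- s) inj j x (w j)].

Definition is_sum2 (N1 N2 M : rep I) : Prop :=
  is_direct_sum (fun b : bool => if b then N1 else N2) M.

Definition direct_summand (N M : rep I) : Prop :=
  exists N' : rep I, is_sum2 N N' M.

(* Indecomposable objects of the full subcategory of rep^pwf(C/I) on the objects
   satisfying S. *)
Definition indecomposable_in (S : rep I -> Prop) (M : rep I) : Prop :=
  [/\ S M, ~ zero_rep M
    & forall N1 N2 : rep I, S N1 -> S N2 -> is_sum2 N1 N2 M ->
        zero_rep N1 \/ zero_rep N2].

Definition indecomposable : rep I -> Prop := indecomposable_in (fun _ => True).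

Definition finite_sum_indecomposables (M : rep I) : Prop :=
  exists (n : nat) (V : 'I_n -> rep I),
    (forall i, indecomposable (V i)) /\ is_direct_sum V M.

Definition in_supp (M : rep I) (x : C) : Prop := ~ (forall v : M x, v = 0).

End Representations.

Section Noise.
Variables (k : fieldType) (T : threadQuiver) (I : ideal (pathcat T k)).

Definition noise (M : rep I) : Prop :=
  forall (v : T) (u : M (Vert v)), u = 0.

Definition noise_free (M : rep I) : Prop :=
  forall N : rep I, direct_summand N M -> noise N -> zero_rep N.

Definition noise_decomposition (M NF : rep I) (U : arrow T -> rep I) : Prop :=
  [/\ noise_free NF,
      forall (a : arrow T) (x : pathcat T k),
        in_supp (U a) x -> exists p : thread a, x = Pt p
    & is_direct_sum (fun o => if o is Some a then U a else NF) M].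

(* The decomposition is unique up to isomorphism of its summands, so it does not
   matter which one is used. *)
Definition quasi_noise_free (M : rep I) : Prop :=
  exists (NF : rep I) (U : arrow T -> rep I),
    noise_decomposition M NF U /\
    forall a, finite_sum_indecomposables (U a).

End Noise.

(* Main.v *)
(** An indecomposable M is either noise free, or isomorphic to a nonzero noise
    summand of itself. Morphisms between different threads pass through a vertex,
    so a noise representation is the direct sum of its restrictions to the
    threads, and an indecomposable one lives on a single thread. Hence every
    indecomposable is quasi noise free. Conversely, let M be indecomposable among
    the quasi noise free representations. If M is noise free, so are its
    summands, and M is indecomposable. Otherwise some thread part U_a is nonzero;
    an indecomposable summand V of U_a splits off from M with a quasi noise free
    complement, which must vanish, so M is isomorphic to V. *)

From HB Require Import structures.
Require Import Defs.
From mathcomp Require Import all_boot all_order all_algebra.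
From mathcomp Require Import boolp.

Set Implicit Arguments.
Unset Strict Implicit.
Unset Printing Implicit Defensive.

Import GRing.Theory.
(* [Defs.hom] is otherwise hidden by [vector.hom]. *)
Import Defs.
Local Open Scope ring_scope.

(** * Morphisms of representations, evaluated pointwise *)

Section Morphisms.
Variables (k : fieldType) (C : linCat k) (I : ideal C).
Implicit Types M N K : rep I.

Lemma rh_naturalE M N (h : repHom M N) (x y : C) (f : hom x y) (v : M x) :
  h y (rep_map M x y f v) = rep_map N x y f (h x v).
Proof. by rewrite -!comp_lfunE rh_natural. Qed.

Lemma rhB M N (h : repHom M N) (x : C) (u v : M x) :
  h x (u - v) = h x u - h x v.
Proof. exact: linearB. Qed.

Lemma rh_sum M N (h : repHom M N) (x : C) (J : Type) (s : seq J) (F : J -> M x) :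
  h x (\sum_(j <- s) F j) = \sum_(j <- s) h x (F j).
Proof. exact: linear_sum. Qed.

Lemma rh1_natural M (x y : C) (f : hom x y) :
  (\1 \o rep_map M x y f = rep_map M x y f \o \1)%VF.
Proof. by rewrite comp_lfun1l comp_lfun1r. Qed.

Definition rh1 M : repHom M M := RepHom (@rh1_natural M).

Lemma rh1E M (x : C) (v : M x) : rh1 M x v = v.
Proof. by rewrite lfunE. Qed.

Lemma rh0_natural M N (x y : C) (f : hom x y) :
  ((0 : 'Hom(M y, N y)) \o rep_map M x y f = rep_map N x y f \o 0)%VF.
Proof. by rewrite comp_lfun0l comp_lfun0r. Qed.

Definition rh0 M N : repHom M N := RepHom (@rh0_natural M N).

Lemma rh0E M N (x : C) (v : M x) : rh0 M N x v = 0.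
Proof. by rewrite lfunE. Qed.

Lemma rhcomp_natural M N K (g : repHom N K) (h : repHom M N)
    (x y : C) (f : hom x y) :
  ((g y \o h y) \o rep_map M x y f = rep_map K x y f \o (g x \o h x))%VF.
Proof. by apply/lfunP => v; rewrite !comp_lfunE !rh_naturalE. Qed.

Definition rhcomp M N K (g : repHom N K) (h : repHom M N) : repHom M K :=
  RepHom (rhcomp_natural g h).

Lemma rhcompE M N K (g : repHom N K) (h : repHom M N) (x : C) (v : M x) :
  rhcomp g h x v = g x (h x v).
Proof. by rewrite /rhcomp /= comp_lfunE. Qed.

Lemma rhcompl_natural M (e : repHom M M) (x y : C) (f : hom x y) :
  ((\1 - e y) \o rep_map M x y f = rep_map M x y f \o (\1 - e x))%VF.
Proof.
apply/lfunP => v; rewrite !comp_lfunE !add_lfunE !opp_lfunE !id_lfunE.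
by rewrite rh_naturalE linearB.
Qed.

Definition rhcompl M (e : repHom M M) : repHom M M :=
  RepHom (rhcompl_natural e).

Lemma rhcomplE M (e : repHom M M) (x : C) (v : M x) :
  rhcompl e x v = v - e x v.
Proof. by rewrite /rhcompl /= add_lfunE opp_lfunE id_lfunE. Qed.

Definition rh_idem M (e : repHom M M) : Prop :=
  forall (x : C) (v : M x), e x (e x v) = e x v.

Lemma rhcompl_idem M (e : repHom M M) : rh_idem e -> rh_idem (rhcompl e).
Proof. by move=> ee x v; rewrite !rhcomplE rhB ee subrr subr0. Qed.

End Morphisms.

(** * The image of an endomorphism, and its splitting when the endomorphism is idempotent *)

Section Image.
Variables (k : fieldType) (C : linCat k) (I : ideal C).
Variables (M : rep I) (e : repHom M M).

(** Summands are realised as images of idempotents. As the kernel of an idempotent is the image of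
    its complement [rhcompl], this one construction provides both halves of a decomposition. *)
Definition im_obj (x : C) : vectType k := subvs_of (limg (e x)).

Definition im_map (x y : C) (f : hom x y) : 'Hom(im_obj x, im_obj y) :=
  (linfun (vsproj (limg (e y))) \o rep_map M x y f \o linfun vsval)%VF.

(** Naturality of [e] makes its image stable under [rep_map M], so the [vsproj] inside [im_map]
    changes nothing. *)
Lemma im_mapE (x y : C) (f : hom x y) (v : im_obj x) :
  vsval (im_map f v) = rep_map M x y f (vsval v).
Proof.
rewrite /im_map !comp_lfunE !lfunE /= vsprojK //.
have /memv_imgP [u _ ->] := subvsP v.
by rewrite -rh_naturalE memv_img // memvf.
Qed.

Lemma im_map_linear (x y : C) : linear (@im_map x y).
Proof.
move=> c f g; apply/lfunP => v; apply: val_inj.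
rewrite /= im_mapE add_lfunE scale_lfunE linearP /= add_lfunE scale_lfunE.
by rewrite !im_mapE.
Qed.

HB.instance Definition _ (x y : C) :=
  GRing.isLinear.Build k (hom x y) 'Hom(im_obj x, im_obj y) *:%R (@im_map x y)
    (@im_map_linear x y).

Lemma im_id (x : C) : im_map (idm x) = \1%VF.
Proof.
by apply/lfunP => v; apply: val_inj; rewrite /= im_mapE rep_id !id_lfunE.
Qed.

Lemma im_comp (x y z : C) (g : hom y z) (f : hom x y) :
  im_map (comp g f) = (im_map g \o im_map f)%VF.
Proof.
apply/lfunP => v; apply: val_inj.
by rewrite /= comp_lfunE !im_mapE rep_comp comp_lfunE.
Qed.

Lemma im_ideal (x y : C) (f : hom x y) : I x y f -> im_map f = 0.
Proof.
move=> If; apply/lfunP => v; apply: val_inj.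
by rewrite /= im_mapE rep_ideal // !zero_lfunE.
Qed.

Definition imrep : rep I :=
  Rep (rep_map := fun x y => @im_map x y) im_id im_comp im_ideal.

Lemma im_inj_natural (x y : C) (f : hom x y) :
  (linfun (@vsval _ _ (limg (e y))) \o rep_map imrep x y f
   = rep_map M x y f \o linfun vsval)%VF.
Proof.
apply/lfunP => v; rewrite comp_lfunE [RHS]comp_lfunE.
rewrite (lfunE (@vsval _ _ (limg (e y)))) (lfunE (@vsval _ _ (limg (e x)))).
exact: im_mapE.
Qed.

Definition im_inj : repHom imrep M := @RepHom _ _ _ imrep M _ im_inj_natural.

Definition im_corestr (x : C) : 'Hom(M x, im_obj x) :=
  (linfun (vsproj (limg (e x))) \o e x)%VF.

Lemma im_corestrE (x : C) (v : M x) : vsval (im_corestr x v) = e x v.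
Proof. by rewrite comp_lfunE lfunE vsprojK // memv_img // memvf. Qed.

Lemma im_proj_natural (x y : C) (f : hom x y) :
  (im_corestr y \o rep_map M x y f = rep_map imrep x y f \o im_corestr x)%VF.
Proof.
apply/lfunP => v; rewrite comp_lfunE [RHS]comp_lfunE; apply: val_inj.
by rewrite [LHS]im_corestrE [RHS]im_mapE im_corestrE rh_naturalE.
Qed.

Definition im_proj : repHom M imrep := @RepHom _ _ _ M imrep _ im_proj_natural.

Lemma im_injE (x : C) (v : imrep x) : im_inj x v = vsval v.
Proof. exact: lfunE. Qed.

Lemma im_projK (x : C) (v : M x) : im_inj x (im_proj x v) = e x v.
Proof. by rewrite im_injE im_corestrE. Qed.

Lemma im_injI (x : C) (u v : imrep x) : im_inj x u = im_inj x v -> u = v.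
Proof. by rewrite !im_injE => /val_inj. Qed.

Hypothesis ee : rh_idem e.

Lemma im_fix (x : C) (v : imrep x) : e x (im_inj x v) = im_inj x v.
Proof.
rewrite im_injE; have /memv_imgP [u _ ->] := subvsP v.
exact: ee.
Qed.

Lemma im_injK (x : C) (v : imrep x) : im_proj x (im_inj x v) = v.
Proof. by apply: im_injI; rewrite im_projK im_fix. Qed.

End Image.

(** * Direct sums, retracts and idempotents *)

Section DirectSums.
Variables (k : fieldType) (C : linCat k) (I : ideal C).
Implicit Types M N K : rep I.

(** The body of [is_direct_sum] with the structure maps as arguments, so that one choice of them can
    be shared between lemmas. *)
Definition biproduct (J : Type) (N : J -> rep I) M
    (inj : forall j, repHom (N j) M) (proj : forall j, repHom M (N j)) : Prop :=
  [/\ forall (j : J) (x : C) (v : N j x), proj j x (inj j x v) = v,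
      forall (i j : J) (x : C) (v : N i x), i <> j -> proj j x (inj i x v) = 0
    & forall (x : C) (v : M x), exists (s : seq J) (w : forall j, N j x),
        v = \sum_(j <- s) inj j x (w j)].

Section Biproduct.
Variables (J : Type) (N : J -> rep I) (M : rep I).
Variables (inj : forall j, repHom (N j) M) (proj : forall j, repHom M (N j)).

(* In [biproduct] the list [s] may have repetitions; here it is duplicate free,
   so the coefficients are the projections of [v]. *)
Lemma biproduct_expand (x : C) (v : M x) : biproduct inj proj ->
  exists s : seq J, v = \sum_(j <- s) inj j x (proj j x v).
Proof.
case=> injK inj0 span.
have [s' [w ->]] := span x v.
pose s : seq {classic J} := s'; rewrite -/s; exists (undup s).
have sumE i : inj i x (proj i x (\sum_(j <- s) inj j x (w j)))
    = \sum_(j <- s) inj i x (proj i x (inj j x (w j))).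
  by rewrite !linear_sum.
rewrite (eq_bigr _ (fun i _ => sumE i)) exchange_big.
apply: (@eq_big_seq _ _ _ {classic J}) => j js.
rewrite [RHS](bigD1_seq j) ?undup_uniq ?mem_undup //= injK big1 ?addr0 //.
by move=> i /eqP ij; rewrite inj0 ?linear0 // => ji; apply: ij.
Qed.

Lemma biproduct_hom_ext (x : C) (V : vectType k) (f g : 'Hom(M x, V)) :
  biproduct inj proj ->
  (forall j v, f (inj j x v) = g (inj j x v)) -> f = g.
Proof.
case=> _ _ span fg; apply/lfunP => v; have [s [w ->]] := span x v.
by rewrite !linear_sum; apply: eq_bigr => j _; exact: fg.
Qed.

Lemma biproduct_eq0 (x : C) (v : M x) : biproduct inj proj ->
  (forall j, proj j x v = 0) -> v = 0.
Proof.
move=> ds v0; have [s ->] := biproduct_expand v ds.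
by rewrite big1 // => j _; rewrite v0 linear0.
Qed.

Lemma biproduct_ext (x : C) (u v : M x) : biproduct inj proj ->
  (forall j, proj j x u = proj j x v) -> u = v.
Proof.
move=> ds uv; apply/eqP; rewrite -subr_eq0; apply/eqP.
by apply: (biproduct_eq0 ds) => j; rewrite rhB uv subrr.
Qed.

(** The last hypothesis says that [e] is a diagonal matrix. Hence it commutes with inclusions and
    projections up to its diagonal blocks [d j], which inherit idempotence, and its image splits
    into their images. *)
Lemma biproduct_im (e : repHom M M) : biproduct inj proj -> rh_idem e ->
  (forall i j (x : C) (v : N i x), i <> j -> proj j x (e x (inj i x v)) = 0) ->
  is_direct_sum (fun j => imrep (rhcomp (proj j) (rhcomp e (inj j)))) (imrep e).
Proof.
move=> ds ee diag; pose d j := rhcomp (proj j) (rhcomp e (inj j)).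
have [injK inj0 _] := ds.
have dE j x v : d j x v = proj j x (e x (inj j x v)) by rewrite /d !rhcompE.
have eI j x v : e x (inj j x v) = inj j x (d j x v).
  apply: (biproduct_ext ds) => i; rewrite dE.
  by have [<-|ji] := pselect (j = i); rewrite ?injK // diag // inj0.
have eP j x v : proj j x (e x v) = d j x (proj j x v).
  rewrite -!comp_lfunE; congr (fun_of_lfun _ _); move: v => _.
  apply: (biproduct_hom_ext ds) => i w; rewrite comp_lfunE [RHS]comp_lfunE.
  have [<-|ij] := pselect (i = j); first by rewrite injK dE.
  by rewrite diag // inj0 // linear0.
have dd j : rh_idem (d j).
  by move=> x v; rewrite dE -eI ee -dE.
exists (fun j => rhcomp (im_proj e) (rhcomp (inj j) (im_inj (d j)))).
exists (fun j => rhcomp (im_proj (d j)) (rhcomp (proj j) (im_inj e))).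
split=> [j x v|i j x v ij|x v].
- rewrite !rhcompE im_projK -dE; apply: im_injI.
  by rewrite im_projK !im_fix.
- rewrite !rhcompE im_projK diag //; exact: linear0.
have [s sE] := biproduct_expand (im_inj e x v) ds.
exists s, (fun j => im_proj (d j) x (proj j x (im_inj e x v))).
apply: im_injI; rewrite {1}sE rh_sum; apply: eq_bigr => j _.
by rewrite !rhcompE !im_projK -eP im_fix // eI -eP im_fix.
Qed.

End Biproduct.

(** Over a finite index, jointly injective projections force spanning: the difference of [v] and the
    sum of its components is killed by every projection. *)
Lemma is_direct_sum_fin (J : finType) (N : J -> rep I) M
    (inj : forall j, repHom (N j) M) (proj : forall j, repHom M (N j)) :
  (forall j (x : C) (v : N j x), proj j x (inj j x v) = v) ->
  (forall i j (x : C) (v : N i x), i <> j -> proj j x (inj i x v) = 0) ->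
  (forall (x : C) (v : M x), (forall j, proj j x v = 0) -> v = 0) ->
  is_direct_sum N M.
Proof.
move=> injK inj0 proj_inj; exists inj, proj; split=> // x v.
exists (index_enum J), (fun j => proj j x v).
apply/eqP; rewrite -subr_eq0; apply/eqP/proj_inj => j.
rewrite rhB rh_sum (bigD1 j) //= injK big1 ?addr0 ?subrr // => i.
by move=> /eqP ij; rewrite inj0.
Qed.

Lemma is_direct_sum_lift n (N : 'I_n.+1 -> rep I) (i0 : 'I_n.+1) M :
  zero_rep (N i0) -> is_direct_sum N M ->
  is_direct_sum (fun j => N (lift i0 j)) M.
Proof.
move=> N0 [inj [proj ds]]; have [injK inj0 _] := ds.
apply: (@is_direct_sum_fin _ _ _ (fun j => inj (lift i0 j))
  (fun j => proj (lift i0 j))) => [j x v|i j x v ij|x v v0].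
- exact: injK.
- by apply: inj0 => /lift_inj.
- apply: (biproduct_eq0 ds) => j.
  by case: (unliftP i0 j) => [i|] ->; [exact: v0 | exact: N0].
Qed.

Lemma is_direct_sum_single (J : Type) (N : J -> rep I) (j0 : J) :
  (forall j, j <> j0 -> zero_rep (N j)) -> is_direct_sum N (N j0).
Proof.
move=> N0.
(* The type depends on [j], so the identity of [N j0] is transported along [j0 = j]; off [j0] the
   map is zero. *)
pose inj j : repHom (N j) (N j0) :=
  match pselect (j0 = j) with
  | left e => eq_rect j0 (fun i => repHom (N i) (N j0)) (rh1 _) j e
  | right _ => rh0 _ _
  end.
pose proj j : repHom (N j0) (N j) :=
  match pselect (j0 = j) with
  | left e => eq_rect j0 (fun i => repHom (N j0) (N i)) (rh1 _) j e
  | right _ => rh0 _ _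
  end.
exists inj, proj; split=> [j x v|i j x v ij|x v].
- rewrite /inj /proj; case: pselect => [e|/nesym nj]; last first.
    by rewrite [v](N0 _ nj) !linear0.
  by case: j / e v => v /=; rewrite !rh1E.
(* At most one of [i] and [j] equals [j0], so the source or the target is zero. *)
- have [e|/nesym ni] := pselect (j0 = i); last by rewrite [v](N0 _ ni) !linear0.
  by apply: N0 => ej; apply: ij; rewrite ej e.
- exists [:: j0], (fun j => proj j x v).
  rewrite big_seq1 /inj /proj; case: pselect => // e.
  by rewrite (Prop_irrelevance e erefl) /= !rh1E.
Qed.

Definition rep_iso M N : Prop :=
  exists (f : repHom M N) (g : repHom N M),
    (forall (x : C) (v : M x), g x (f x v) = v) /\
    (forall (x : C) (v : N x), f x (g x v) = v).

Lemma rep_iso_sym M N : rep_iso M N -> rep_iso N M.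
Proof. by case=> f [g [fK gK]]; exists g, f. Qed.

Lemma is_direct_sum_iso (J : Type) (N : J -> rep I) M M' :
  rep_iso M M' -> is_direct_sum N M -> is_direct_sum N M'.
Proof.
case=> f [g [fK gK]] [inj [proj [injK inj0 span]]].
exists (fun j => rhcomp f (inj j)), (fun j => rhcomp (proj j) g).
split=> [j x v|i j x v ij|x v].
- by rewrite !rhcompE fK injK.
- by rewrite !rhcompE fK inj0.
- have [s [w gv]] := span x (g x v); exists s, w.
  rewrite -(gK x v) gv rh_sum.
  by apply: eq_bigr => j _; rewrite rhcompE.
Qed.

Lemma is_direct_sum_single_iso (J : Type) (N : J -> rep I) (j0 : J) M :
  (forall j, j <> j0 -> zero_rep (N j)) -> is_direct_sum N M ->
  rep_iso (N j0) M.
Proof.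
move=> N0 [inj [proj ds]]; have [injK _ _] := ds.
exists (inj j0), (proj j0); split=> // x v.
apply: (biproduct_ext ds) => j.
have [->|j0j] := pselect (j = j0); first by rewrite injK.
by rewrite [LHS](N0 _ j0j) [RHS](N0 _ j0j).
Qed.

(** Equivalent to [direct_summand] by [direct_summandP], but without a complement to carry along,
    which makes transitivity immediate. *)
Definition retract N M : Prop :=
  exists (i : repHom N M) (p : repHom M N),
    forall (x : C) (v : N x), p x (i x v) = v.

Lemma retract_trans M N K : retract K N -> retract N M -> retract K M.
Proof.
case=> i [p pK] [i' [p' pK']]; exists (rhcomp i' i), (rhcomp p p') => x v.
by rewrite !rhcompE pK' pK.
Qed.

Lemma retract_zero M N (x : C) :
  retract N M -> (forall v : M x, v = 0) -> forall v : N x, v = 0.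
Proof. by case=> i [p pK] M0 v; rewrite -(pK x v) (M0 (i x v)) linear0. Qed.

Lemma rep_iso_retract M N : rep_iso M N -> retract M N.
Proof. by case=> f [g [fK _]]; exists f, g. Qed.

Lemma is_direct_sum_retract (J : Type) (N : J -> rep I) M (j : J) :
  is_direct_sum N M -> retract (N j) M.
Proof. by case=> inj [proj [injK _ _]]; exists (inj j), (proj j). Qed.

Lemma imrep_retract M (e : repHom M M) : rh_idem e -> retract (imrep e) M.
Proof.
by move=> ee; exists (im_inj e), (im_proj e) => x v; rewrite im_injK.
Qed.

Lemma imrep_zero M (e : repHom M M) (x : C) :
  (forall v : M x, e x v = 0) -> forall v : imrep e x, v = 0.
Proof.
move=> e0 v; apply: im_injI; rewrite linear0 im_injE.
by have /memv_imgP [u _ ->] := subvsP v; exact: e0.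
Qed.

Lemma imrep_iso M (e : repHom M M) :
  (forall (x : C) (v : M x), e x v = v) -> rep_iso (imrep e) M.
Proof.
move=> e1; have ee : rh_idem e by move=> x v; rewrite !e1.
exists (im_inj e), (im_proj e).
by split=> x v; [exact: im_injK | rewrite im_projK e1].
Qed.

Lemma retract_idem M N (i : repHom N M) (p : repHom M N) :
  (forall (x : C) (v : N x), p x (i x v) = v) -> rh_idem (rhcomp i p).
Proof. by move=> pK x v; rewrite !rhcompE pK. Qed.

(** The complement is the image of the idempotent 1 - ip. *)
Lemma retract_sum2 M N (i : repHom N M) (p : repHom M N) :
  (forall (x : C) (v : N x), p x (i x v) = v) ->
  is_sum2 N (imrep (rhcompl (rhcomp i p))) M.
Proof.
move=> pK; set e := rhcompl _.
have ee : rh_idem e by apply: rhcompl_idem; exact: retract_idem.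
have eE x v : e x v = v - i x (p x v) by rewrite rhcomplE rhcompE.
pose inj (b : bool) : repHom (if b then N else imrep e) M :=
  if b as b return repHom (if b then N else imrep e) M then i else im_inj e.
pose proj (b : bool) : repHom M (if b then N else imrep e) :=
  if b as b return repHom M (if b then N else imrep e) then p else im_proj e.
apply: (@is_direct_sum_fin _ _ _ inj proj) => [[] x v|[] [] x v // _|x v v0].
- exact: pK.
- exact: im_injK.
- by apply: im_injI; rewrite im_projK linear0 eE pK subrr.
- by rewrite -[im_inj e x v]im_fix // eE rhB pK subrr.
- have := congr1 (im_inj e x) (v0 false).
  by rewrite im_projK linear0 eE (v0 true : p x v = 0) linear0 subr0.
Qed.

Lemma direct_summandP N M : direct_summand N M <-> retract N M.
Proof.
split=> [[N' ds]|[i [p pK]]]; first exact: (is_direct_sum_retract true ds).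
by exists (imrep (rhcompl (rhcomp i p))); exact: retract_sum2.
Qed.

(** The idempotent cutting out the complement [W] of [K] is diagonal for the given decomposition: it
    is the identity on every block except [j0], where it is 1 - ip. So [W] decomposes over the same
    index type, with only the block [j0] shrunk. *)
Lemma is_direct_sum_complement (J : Type) (N : J -> rep I) M (j0 : J) K
    (i : repHom K (N j0)) (p : repHom (N j0) K) :
  (forall (x : C) (v : K x), p x (i x v) = v) -> is_direct_sum N M ->
  exists (W : rep I) (e : forall j, repHom (N j) (N j)),
    [/\ is_sum2 K W M, is_direct_sum (fun j => imrep (e j)) W,
        forall j, rh_idem (e j),
        forall j (x : C) (v : N j x), j <> j0 -> e j x v = v
      & forall (x : C) (v : N j0 x), e j0 x v = v - i x (p x v)].
Proof.
move=> pK [inj [proj ds]]; have [injK inj0 _] := ds.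
pose i' := rhcomp (inj j0) i; pose p' := rhcomp p (proj j0).
have p'K (x : C) (v : K x) : p' x (i' x v) = v.
  by rewrite /p' /i' !rhcompE injK pK.
pose e := rhcompl (rhcomp i' p').
have ee : rh_idem e by apply: rhcompl_idem; exact: retract_idem.
have eE x v : e x v = v - inj j0 x (i x (p x (proj j0 x v))).
  by rewrite /e /i' /p' rhcomplE !rhcompE.
have eI j x v : j <> j0 -> e x (inj j x v) = inj j x v.
  by move=> jj0; rewrite eE inj0 // !linear0 addr0.
have diag j j' x v : j <> j' -> proj j' x (e x (inj j x v)) = 0.
  move=> jj'; have [jj0|/eI ->] := pselect (j = j0); last exact: inj0.
  by subst j; rewrite eE rhB !inj0 // subr0.
pose d j := rhcomp (proj j) (rhcomp e (inj j)).
have d1 j x v : j <> j0 -> d j x v = v.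
  by move=> /eI jj0; rewrite /d !rhcompE jj0 injK.
have d0 x v : d j0 x v = v - i x (p x v).
  by rewrite /d !rhcompE eE rhB !injK.
exists (imrep e), d; split=> //; first exact: retract_sum2.
  exact: biproduct_im.
move=> j x v; have [jj0|jj0] := pselect (j = j0); last by rewrite !d1.
by subst j; rewrite d0 [X in p x X]d0 rhB pK subrr linear0 subr0.
Qed.

Lemma is_sum2_isol N1 N2 M : zero_rep N2 -> is_sum2 N1 N2 M -> rep_iso N1 M.
Proof.
move=> N20; apply: (@is_direct_sum_single_iso _ _ true).
by case=> [/(_ erefl)|_].
Qed.

Lemma indecomposable_iso M N :
  rep_iso M N -> indecomposable M -> indecomposable N.
Proof.
move=> MN [_ M0 Mind]; split=> // [N0|N1 N2 _ _ ds].
  by apply: M0 => x; apply: retract_zero (rep_iso_retract MN) (N0 x).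
exact/Mind/(is_direct_sum_iso (rep_iso_sym MN)).
Qed.

Lemma finite_sum_zero M : zero_rep M -> finite_sum_indecomposables M.
Proof.
(* The empty sum: the family over ['I_0] is a dummy. *)
move=> M0; exists 0, (fun=> M); split; first by case.
exists (fun=> rh1 M), (fun=> rh1 M).
by split=> [[]|[]|x v] //; exists [::], (fun=> 0); rewrite big_nil; exact: M0.
Qed.

Lemma finite_sum_indecomposable M :
  indecomposable M -> finite_sum_indecomposables M.
Proof.
move=> Mind; exists 1, (fun=> M); split=> //.
apply: (@is_direct_sum_single _ (fun _ : 'I_1 => M) ord0) => j.
by rewrite ord1.
Qed.

Lemma finite_sum_iso M N : rep_iso M N ->
  finite_sum_indecomposables M -> finite_sum_indecomposables N.
Proof.
move=> MN [n [V [Vind ds]]]; exists n, V; split=> //.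
exact: is_direct_sum_iso MN ds.
Qed.

(** The blocks of [e] are zero at [i0] and the identity elsewhere. Its image is thus the sum of the
    other [V j], reindexed through [lift i0]. *)
Lemma finite_sum_drop n (V : 'I_n -> rep I) (i0 : 'I_n) M
    (inj : forall j, repHom (V j) M) (proj : forall j, repHom M (V j))
    (e : repHom M M) :
  (forall j, indecomposable (V j)) -> biproduct inj proj ->
  (forall (x : C) (v : M x), e x v = v - inj i0 x (proj i0 x v)) ->
  finite_sum_indecomposables (imrep e).
Proof.
case: n V i0 inj proj => [|n] V i0 inj proj; first by case: i0.
move=> Vind ds eE; have [injK inj0 _] := ds.
have eI j x v : j <> i0 -> e x (inj j x v) = inj j x v.
  by move=> ji; rewrite eE inj0 // linear0 subr0.
have eI0 x v : e x (inj i0 x v) = 0 by rewrite eE injK subrr.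
have ee : rh_idem e.
  by move=> x v; rewrite [X in e x X]eE rhB eI0 subr0.
exists n, (fun j =>
  imrep (rhcomp (proj (lift i0 j)) (rhcomp e (inj (lift i0 j))))).
split=> [j|].
  apply: indecomposable_iso (Vind (lift i0 j)); apply/rep_iso_sym/imrep_iso.
  move=> x v; rewrite !rhcompE eI ?injK //.
  by apply/eqP; rewrite eq_sym neq_lift.
apply: (@is_direct_sum_lift _
  (fun j => imrep (rhcomp (proj j) (rhcomp e (inj j))))).
  by move=> x; apply: imrep_zero => v; rewrite !rhcompE eI0 linear0.
apply: biproduct_im => // i j x v ij.
by have [i_i0|] := pselect (i = i0); [subst i; rewrite eI0 linear0
  | move/eI => ->; exact: inj0].
Qed.

End DirectSums.

(** * Noise, threads and quasi noise free representations *)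

Section Noise.
Variables (k : fieldType) (T : threadQuiver) (I : ideal (pathcat T k)).
Implicit Types M N : rep I.

Lemma noise_free_retract M N : retract N M -> noise_free M -> noise_free N.
Proof.
move=> NM Mnf K /direct_summandP KN; apply: Mnf; apply/direct_summandP.
exact: retract_trans KN NM.
Qed.

Lemma noise_free_zero M : zero_rep M -> noise_free M.
Proof.
by move=> M0 N /direct_summandP NM _ x; apply: retract_zero NM (M0 x).
Qed.

Lemma noise_retract M N : retract N M -> noise M -> noise N.
Proof. by move=> NM Mn v; apply: retract_zero NM (Mn v). Qed.

Lemma quasi_noise_free_nf M : noise_free M -> quasi_noise_free M.
Proof.
(* A zero representation, obtained as the image of the zero endomorphism, fills all thread parts. *)
move=> Mnf; pose Z := imrep (rh0 M M).
have Z0 : zero_rep Z by move=> x; apply: imrep_zero => v; rewrite rh0E.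
exists M, (fun=> Z); split; last by move=> _; exact: finite_sum_zero.
split=> // [a x []|]; first exact: Z0.
by apply: (@is_direct_sum_single _ _ _ _
  (fun o => if o is Some _ then Z else M) None) => -[].
Qed.

Lemma quasi_noise_free_thread M (a : arrow T) :
  (forall x : pathcat T k, in_supp M x -> exists p : thread a, x = Pt p) ->
  finite_sum_indecomposables M -> quasi_noise_free M.
Proof.
move=> Msupp Mfin; pose Z := imrep (rh0 M M).
have Z0 : zero_rep Z by move=> x; apply: imrep_zero => v; rewrite rh0E.
pose U b := if pselect (b = a) then M else Z.
have Ua : U a = M by rewrite /U; case: pselect.
have U0 b : b <> a -> U b = Z by rewrite /U; case: pselect.
exists Z, U; split; last first.
  move=> b; have [->|/U0 ->] := pselect (b = a); first by rewrite Ua.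
  exact: finite_sum_zero.
split; first exact: noise_free_zero.
  move=> b x; have [->|/U0 ->] := pselect (b = a); first by rewrite Ua => /Msupp.
  by case; exact: Z0.
rewrite -Ua.
apply: (@is_direct_sum_single _ _ _ _ (fun o => if o is Some b then U b else Z)
  (Some a)) => -[b ba|_]; last exact: Z0.
by rewrite U0 // => ab; apply: ba; rewrite ab.
Qed.

Section ThreadPart.
Variables (M : rep I) (a : arrow T).
Hypothesis Mnoise : noise M.

(* A morphism between different threads passes through a vertex, where [M]
   vanishes. *)
Lemma noise_Via (x y : tobj T) (p : qpath (tout x) (tin y)) :
  rep_map M x y (lbase k (Via p : @chom (plike_cat T) x y)) = 0.
Proof.
have -> : lbase k (Via p : @chom (plike_cat T) x y) =
    @comp k (pathcat T k) x (Vert (tout x)) y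
      (lbase k (@Via T (Vert (tout x)) y p : @chom (plike_cat T) _ _))
      (lbase k (@Via T x (Vert (tout x)) (qnil (tout x)) :
        @chom (plike_cat T) _ _)).
  by rewrite /= lcompU.
apply/lfunP => v; rewrite rep_comp comp_lfunE zero_lfunE.
by rewrite (Mnoise (rep_map M _ _ _ v)) linear0.
Qed.

Definition on_thread (x : tobj T) : Prop := exists p : thread a, x = Pt p.

Definition thread_proj (x : pathcat T k) : 'Hom(M x, M x) :=
  if pselect (on_thread x) then \1%VF else 0.

(** A [Dir] element stays within one thread, and a [Via] element acts as zero. *)
Lemma plike_on_thread (x y : tobj T) (g : plike x y) :
  (on_thread x <-> on_thread y) \/
  rep_map M x y (lbase k (g : @chom (plike_cat T) x y)) = 0.
Proof.
case: g => [{}x {}y p|b {}x {}y xy]; first by right; exact: noise_Via.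
by left; split=> -[p [ba _]]; subst b; [exists y | exists x].
Qed.

Lemma thread_proj_natural (x y : pathcat T k) (f : hom x y) :
  (thread_proj y \o rep_map M x y f = rep_map M x y f \o thread_proj x)%VF.
Proof.
(* Both sides are linear in [f], so path-like elements suffice. *)
move: f; apply: eq_linear_malg => [c f g|c f g|g].
- by rewrite linearP comp_lfunDr comp_lfunZr.
- by rewrite linearP comp_lfunDl comp_lfunZl.
have [xy|] := plike_on_thread g; last first.
  by rewrite /lbase => ->; rewrite comp_lfun0l comp_lfun0r.
rewrite /thread_proj; case: pselect => hy; case: pselect => hx.
- by rewrite comp_lfun1l comp_lfun1r.
- by case: hx; apply/xy.
- by case: hy; apply/xy.
- by rewrite comp_lfun0l comp_lfun0r.
Qed.

Definition thread_part : repHom M M := RepHom thread_proj_natural.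

Lemma thread_partE (x : pathcat T k) (v : M x) :
  on_thread x -> thread_part x v = v.
Proof.
by move=> h; rewrite /= /thread_proj; case: pselect => // ? /=; rewrite id_lfunE.
Qed.

Lemma thread_part0 (x : pathcat T k) (v : M x) :
  ~ on_thread x -> thread_part x v = 0.
Proof.
move=> h; rewrite /= /thread_proj; case: pselect => // ? /=.
by rewrite zero_lfunE.
Qed.

Lemma thread_part_idem : rh_idem thread_part.
Proof.
move=> x v; have [h|h] := pselect (on_thread x).
  by rewrite !thread_partE.
by rewrite !thread_part0.
Qed.

End ThreadPart.

(** Some point of a thread [a] carries a nonzero vector. The idempotent [thread_part] for [a] splits
    [M]; its image is nonzero, so the complement, which contains everything off [a], vanishes. *)
Lemma indecomposable_noise M : indecomposable M -> noise M ->
  exists a : arrow T, forall x : pathcat T k, in_supp M x -> on_thread a x.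
Proof.
move=> [_ M0 Mind] Mnoise.
have [x [u u0]] : exists (x : pathcat T k) (u : M x), u <> 0.
  apply: contrapT => none; apply: M0 => x v.
  by apply: contrapT => v0; apply: none; exists x, v.
case: x u u0 => [v u []|a p u u0]; first exact: Mnoise.
exists a; pose e := thread_part a Mnoise.
have ee : rh_idem e := thread_part_idem a Mnoise.
have /Mind[]// := retract_sum2 (im_injK ee) => [e0|e0] x.
  case: u0; rewrite -[u](thread_partE Mnoise (a := a)); last by exists p.
  by rewrite -/e -im_projK (e0 _ (im_proj e _ u)) linear0.
(* Off the thread, [v] equals its own component in the zero complement. *)
move=> Mx; apply: contrapT => ax; apply: Mx => v.
have := congr1 (im_inj _ x) (e0 x (im_proj _ x v)).
rewrite linear0 im_projK rhcomplE rhcompE im_projK thread_part0 // subr0.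
exact.
Qed.

Lemma indecomposable_quasi_noise_free M : indecomposable M -> quasi_noise_free M.
Proof.
move=> Mind; have [Mnf|] := pselect (noise_free M).
  exact: quasi_noise_free_nf.
(* A nonzero noise summand [N] has zero complement, so [M] is isomorphic to it. *)
move=> /existsNP [N /not_implyP [[N' ds] /not_implyP [Nn N0]]].
have [_ _ /(_ N N' Logic.I Logic.I ds) []// N'0] := Mind.
have Mnoise : noise M.
  exact: noise_retract (rep_iso_retract (rep_iso_sym (is_sum2_isol N'0 ds))) Nn.
have [a Msupp] := indecomposable_noise Mind Mnoise.
exact: quasi_noise_free_thread Msupp (finite_sum_indecomposable Mind).
Qed.

(** Some [U a] is nonzero, as otherwise [M] would be isomorphic to [NF]. Removing one indecomposable
    [V i0] from [U a] leaves a noise decomposition of the complement: up to isomorphism the other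
    parts are unchanged, and [U a] keeps finitely many summands. *)
Lemma quasi_noise_free_split M : quasi_noise_free M -> ~ noise_free M ->
  exists2 V, indecomposable V &
    exists2 W, quasi_noise_free W & is_sum2 V W M.
Proof.
case=> NF [U [[NFnf Usupp ds] Ufin]] Mnf.
have [a Ua] : exists a, ~ zero_rep (U a).
  apply: contrapT => U0; apply: Mnf; apply: noise_free_retract NFnf.
  apply/rep_iso_retract/rep_iso_sym.
  apply: (is_direct_sum_single_iso (j0 := None)) ds => -[b _|//].
  by apply: contrapT => Ub; apply: U0; exists b.
have [n [V [Vind [inja [proja dsa]]]]] := Ufin a.
(* An empty sum would make [U a] zero. *)
have [i0 _] : exists i0 : 'I_n, True.
  apply: contrapT => n0; apply: Ua => x v; apply: (biproduct_eq0 dsa) => j.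
  by case: n0; exists j.
have [injaK inja0 _] := dsa.
exists (V i0) => //.
have [W [e [VW dsW ee e1 e0]]] :=
  is_direct_sum_complement (j0 := Some a) (injaK i0) ds.
exists W => //; exists (imrep (e None)), (fun b => imrep (e (Some b))).
split; last first.
  move=> b; have [->|ba] := pselect (b = a).
    exact: finite_sum_drop Vind dsa e0.
  apply: finite_sum_iso (Ufin b); apply/rep_iso_sym/imrep_iso => x v.
  by apply: (e1 (Some b)) => -[].
split.
- exact: noise_free_retract (imrep_retract (ee None)) NFnf.
- move=> b x bx; apply: Usupp => Ub; apply: bx.
  exact: retract_zero (imrep_retract (ee (Some b))) Ub.
(* The two families agree only after a case split on the [option] index. *)
- by move: dsW; congr is_direct_sum; apply: funext => -[].
Qed.

End Noise.

Theorem corollary4p7 (k : closedFieldType) (T : threadQuiver)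
    (I : ideal (pathcat T k)) (M : rep I) :
  indecomposable M <-> indecomposable_in (@quasi_noise_free k T I) M.
Proof.
split=> [Mind|[Mqnf M0 Mind]].
  have [_ M0 Msum] := Mind; split=> //.
    exact: indecomposable_quasi_noise_free.
  by move=> N1 N2 _ _; exact: Msum.
have [Mnf|/(quasi_noise_free_split Mqnf)[V Vind [W Wqnf ds]]] :=
  pselect (noise_free M).
  (* Summands of a noise free [M] are noise free, so every decomposition already lies in the
     subcategory. *)
  split=> // N1 N2 _ _ ds; apply: Mind => //; apply: quasi_noise_free_nf.
    exact: noise_free_retract (is_direct_sum_retract true ds) Mnf.
  exact: noise_free_retract (is_direct_sum_retract false ds) Mnf.
(* The first direction puts [V] in the subcategory, so [Mind] applies to [V] and [W]; as [V] is
   nonzero, [W] vanishes. *)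
have Vqnf := indecomposable_quasi_noise_free Vind.
have [V0|W0] := Mind V W Vqnf Wqnf ds; first by case: Vind.
exact: indecomposable_iso (is_sum2_isol W0 ds) Vind.
Qed.
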